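(* Let $(\Omega,\mathcal{F})$ be a standard Borel space, let $E$ be an equivalence relation on $\Omega$, and let $\mathcal{G}$ be a sub-$\sigma$-algebra of $\mathcal{F}$. Suppose that $E\subseteq\mathcal{G}^{\ast}$ (equivalently, $\mathcal{G}\subseteq E^{\ast}$) and that $E\in\mathcal{G}\otimes\mathcal{G}$. Then the pair $(E,\mathcal{G})$ satisfies strong duality.
   Context: For a relation $E\subseteq\Omega\times\Omega$, $E^{\ast}:=\{A\in\mathcal{F}:\forall(\omega,\omega')\in E,\ (\omega\in A\Leftrightarrow\omega'\in A)\}$. For $\mathcal{G}\subseteq\mathcal{F}$, $\mathcal{G}^{\ast}:=\{(\omega,\omega')\in\Omega\times\Omega:\forall A\in\mathcal{G},\ (\omega\in A\Leftrightarrow\omega'\in A)\}$. $\mathcal{P}(\Omega,\mathcal{F})$ is the set of probability measures on $(\Omega,\mathcal{F})$, and for $\mathbb{P},\mathbb{P}'\in\mathcal{P}(\Omega,\mathcal{F})$, $\Pi(\mathbb{P},\mathbb{P}')$ is the set of couplings, i.e. probability measures on $(\Omega\times\Omega,\mathcal{F}\otimes\mathcal{F})$ with first marginal $\mathbb{P}$ and second marginal $\mathbb{P}'$. The pair $(E,\mathcal{G})$ satisfies strong duality if $E\in\mathcal{F}\otimes\mathcal{F}$ and, for all $\mathbb{P},\mathbb{P}'\in\mathcal{P}(\Omega,\mathcal{F})$, $$\max_{A\in\mathcal{G}}|\mathbb{P}(A)-\mathbb{P}'(A)|=\min_{\tilde{\mathbb{P}}\in\Pi(\mathbb{P},\mathbb{P}')}(1-\tilde{\mathbb{P}}(E)),$$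 where max and min assert that the supremum and infimum are both attained. *)

(* Defs.v *)
From mathcomp Require Import all_boot all_order all_algebra.
From mathcomp Require Import all_classical all_reals all_analysis.

Set Implicit Arguments.
Unset Strict Implicit.
Unset Printing Implicit Defensive.

Import Order.TTheory GRing.Theory Num.Theory.
Import numFieldNormedType.Exports.

Local Open Scope classical_set_scope.
Local Open Scope ring_scope.

Definition polish_metric (R : realType) (X : metricType R) : Prop :=
  (exists2 D : set X, countable D & dense D) /\
  (forall F : set_system X, ProperFilter F -> cauchy F -> exists x : X, F --> x).

(* As f is a bijection, the equivalence says that f and its inverse are both
   measurable, the sigma-algebra of X being the Borel one. *)
Definition standard_borel (R : realType) (d : measure_display)
    (T : measurableType d) : Prop :=
  exists (X : metricType R) (f : T -> X),
    [/\ polish_metric X, bijective f &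
        forall B : set X, measurable (f @^-1` B) <-> <<s @open X >> B].

(* The relation written G^* : no member of G separates the two points. *)
Definition indistinguishable (T : Type) (G : set (set T)) : set (T * T) :=
  [set w | forall A, G A -> (A w.1 <-> A w.2)].

(* For a sigma-algebra G on T that is not the canonical one of T; on the
   canonical one this is the library's product sigma-algebra, see
   [measurable_prod_measurableType]. *)
Definition prod_sigma_algebra (T1 T2 : Type)
    (G1 : set (set T1)) (G2 : set (set T2)) : set (set (T1 * T2)) :=
  <<s [set A `*` B | A in G1 & B in G2] >>.

(* The marginals are compared on measurable sets only: a measure is a function
   on all sets, whose values on non-measurable sets are irrelevant. *)
Definition couplings (R : realType) (d : measure_display)
    (T : measurableType d) (P P' : probability T R) :
    set (probability (T * T)%type R) :=
  [set Q | forall A : set T, measurable A ->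
     pushforward Q fst A = P A /\ pushforward Q snd A = P' A].

Definition is_max (R : realType) (S : set (\bar R)) (m : \bar R) : Prop :=
  S m /\ ubound S m.

Definition is_min (R : realType) (S : set (\bar R)) (m : \bar R) : Prop :=
  S m /\ lbound S m.

Definition strong_duality (R : realType) (d : measure_display)
    (T : measurableType d) (E : set (T * T)) (G : set (set T)) : Prop :=
  measurable E /\
  forall P P' : probability T R,
    exists m : \bar R,
      is_max [set `|P A - P' A|%E | A in G] m /\
      is_min [set (1 - Q E)%E | Q in couplings P P'] m.

(* Main.v *)
(* Let Y be the space T with the coarser sigma-algebra G, let pi : T -> Y be the
   identity, and let mu, mu' be the images of P, P' under pi. As T is standard
   Borel, P is recovered from mu with the help of an independent uniform
   variable: there is a measurable g : Y * R -> T such that (g (y, u), y) has the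
   law of (x, pi x) under P; likewise for P'. Hence every coupling L of mu and
   mu' lifts to a coupling Q of P and P', the law of (g (y, u), g' (y', v)).
   Since E is reflexive, (g (y, u), y) belongs to E almost surely, and so does
   (g' (y', v), y'); as E is symmetric and transitive, (y, y') in E then implies
   (g (y, u), g' (y', v)) in E, so Q (~` E) <= L (~` E). Taking for L the maximal
   coupling of mu and mu', which puts the common part of mu and mu' on the
   diagonal, gives L (~` E) <= mu A - mu' A for a Hahn set A of mu - mu', which
   belongs to G. The reverse inequality holds for any coupling because the
   members of G do not separate E-equivalent points. *)
Require Import Defs.
From HB Require Import structures.
From mathcomp Require Import all_boot all_order all_algebra.
From mathcomp Require Import all_classical all_reals all_analysis.
From mathcomp Require Import measurable_realfun ring lra.

Set Implicit Arguments.
Unset Strict Implicit.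
Unset Printing Implicit Defensive.

Import Order.TTheory GRing.Theory Num.Theory.
Import numFieldNormedType.Exports.

Local Open Scope classical_set_scope.
Local Open Scope ring_scope.

(** * Image measures and almost everywhere statements *)

Definition mfun_of d1 d2 (T1 : measurableType d1) (T2 : measurableType d2)
    (f : T1 -> T2) (mf : measurable_fun setT f) : {mfun T1 >-> T2} :=
  HB.pack f (isMeasurableFun.Build _ _ _ _ f mf).

Section image_measure.
Context d1 d2 (T1 : measurableType d1) (T2 : measurableType d2) (R : realType).
Context (mu : {finite_measure set T1 -> \bar R}) (f : {mfun T1 >-> T2}).

(** Bundling the map lets the image of a finite measure that is not a probability carry a finite
    measure structure. *)
Definition image_measure : set T2 -> \bar R := pushforward mu f.

Let image_measure0 : image_measure set0 = 0%E.
Proof. exact: measure0. Qed.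

Let image_measure_ge0 A : (0 <= image_measure A)%E.
Proof. exact: measure_ge0. Qed.

Let image_measure_sigma_additive : semi_sigma_additive image_measure.
Proof. exact: measure_semi_sigma_additive. Qed.

HB.instance Definition _ := isMeasure.Build _ _ _ image_measure
  image_measure0 image_measure_ge0 image_measure_sigma_additive.

Let image_measure_fin : fin_num_fun image_measure.
Proof.
move=> A mA; apply: fin_num_measure.
by rewrite -[X in measurable X]setTI; exact: measurable_funP.
Qed.

HB.instance Definition _ :=
  Measure_isFinite.Build _ _ _ image_measure image_measure_fin.

End image_measure.

(** On the set [N] where [g < f] the reverse inequality of integrals holds too, so [f] and [g] have
    equal integrals over every measurable part of [N] and agree almost everywhere on it. Hence [N]
    is null. *)
Lemma ae_le_of_integral_le d (T : measurableType d) (R : realType)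
    (mu : {measure set T -> \bar R}) (f g : T -> \bar R) :
  mu.-integrable setT f -> mu.-integrable setT g ->
  (forall A, measurable A ->
    \int[mu]_(x in A) f x <= \int[mu]_(x in A) g x)%E ->
  {ae mu, forall x, f x <= g x}%E.
Proof.
move=> fi gi fg.
have mf := measurable_int _ fi; have mg := measurable_int _ gi.
pose N := [set x | g x < f x]%E.
have mN : measurable N by rewrite -[N]setTI; exact: measurable_lte.
have : ae_eq mu N f g.
  apply: integral_ae_eq => //.
  - exact: (integrableS measurableT).
  - exact: measurable_funTS.
  move=> A AN mA; apply/eqP; rewrite eq_le fg//=.
  apply: le_integral => //.
  - exact: (integrableS measurableT).
  - exact: (integrableS measurableT).
  by move=> x /[!inE] /AN /ltW.
apply: filterS => x /= fgx; rewrite leNgt; apply/negP => xN.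
by move: (xN); rewrite fgx ?ltxx.
Qed.

Lemma ae_forall_countable d (T : measurableType d) (R : realType)
    (mu : {measure set T -> \bar R}) (I : countType) (P : I -> T -> Prop) :
  (forall i, {ae mu, forall x, P i x}) -> {ae mu, forall x, forall i, P i x}.
Proof.
move=> aeP.
pose Q n x := if unpickle n is Some i then P i x else True.
have : {ae mu, forall x, forall n, Q n x}.
  apply: ae_foralln => n; rewrite /Q.
  by case: unpickle => [i|]; [exact: aeP | exact: aeW].
by apply: filterS => x QP i; have := QP (pickle i); rewrite /Q pickleK.
Qed.

(** In the application [nu p] is the part of [mu] on which a variable is at most [p], and [F p] is
    its conditional distribution function at [p]. Inequalities between measures pass to their
    Radon-Nikodym densities almost everywhere, and countably many indices leave a single null set to
    repair. *)
Lemma monotone_densities d (Y : measurableType d) (R : realType)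
    (mu : probability Y R) (nu : rat -> {finite_measure set Y -> \bar R}) :
  (forall p q A, p <= q -> measurable A -> (nu p A <= nu q A)%E) ->
  (forall p A, measurable A -> (nu p A <= mu A)%E) ->
  exists F : rat -> Y -> R, [/\
    forall p, measurable_fun setT (F p),
    forall p y, 0 <= F p y <= 1,
    forall p q y, p <= q -> F p y <= F q y &
    forall p A, measurable A -> nu p A = (\int[mu]_(y in A) (F p y)%:E)%E].
Proof.
move=> nu_nd nu_le.
have nu_dom p : nu p `<< mu.
  apply/null_content_dominatesP => A mA mA0; apply/eqP.
  by rewrite -measure_le0 -mA0 nu_le.
have /choice[f fP] p := radon_nikodym_sigma_finite (nu_dom p).
have f0 p y : (0 <= f p y)%E by have [] := fP p.
have ffin p y : f p y \is a fin_num by have [] := fP p.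
have fint p : mu.-integrable setT (f p) by have [] := fP p.
have fE p A : measurable A -> nu p A = (\int[mu]_(y in A) f p y)%E.
  by have [_ _ _] := fP p; exact.
have f_nd p q : p <= q -> {ae mu, forall y, f p y <= f q y}%E.
  move=> pq; apply: ae_le_of_integral_le => // A mA.
  by rewrite -!fE// nu_nd.
have f_le1 p : {ae mu, forall y, f p y <= 1}%E.
  apply: (@ae_le_of_integral_le _ _ _ _ _ (cst 1%E)) => //.
    exact: finite_measure_integrable_cst.
  by move=> A mA; rewrite -fE// integral_cst// mul1e nu_le.
have [B [mB muB0 subB]] : {ae mu, forall y, forall pq : rat * rat,
    ((pq.1 <= pq.2)%R -> f pq.1 y <= f pq.2 y)%E /\ (f pq.1 y <= 1)%E}.
  apply: ae_forall_countable => -[p q] /=.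
  apply: filterS2 (f_le1 p) _.
    by move=> y f1 fpq; split; [exact: fpq | exact: f1].
  have [pq|qp] := leP p q; last exact: aeW.
  by apply: filterS (f_nd p q pq) => y + _.
(* The Radon-Nikodym densities are monotone in p and at most 1 off the null set
   B only, so they are replaced on B by a constant. *)
pose F p y := if y \in B then 1 else fine (f p y).
have mF p : measurable_fun setT (F p).
  apply: measurable_fun_ifT => //=.
    apply: (measurable_fun_bool true); rewrite setTI.
    rewrite [X in measurable X](_ : _ = B)//.
    by apply/seteqP; split => y /=; [exact: set_mem | exact: mem_set].
  apply: measurableT_comp => //.
  exact: measurable_int _ (fint p).
exists F; split => //; rewrite /F.
- move=> p y; case: ifPn => [|yB]; first by rewrite ler01 lexx.
  rewrite fine_ge0//=; rewrite -lee_fin fineK//.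
  apply: contrapT => np.
  move/negP: yB; apply; rewrite inE; apply: subB => /= H.
  by apply: np; have [] := H (p, p).
- move=> p q y pq; case: ifPn => // yB.
  rewrite fine_le//; apply: contrapT => np.
  move/negP: yB; apply; rewrite inE; apply: subB => /= H.
  by apply: np; have [+ _] := H (p, q); apply.
- move=> p A mA; rewrite fE//; apply: ge0_ae_eq_integral => //.
  - apply: measurable_funTS => //; exact: measurable_int _ (fint p).
  - by apply: measurable_funTS; apply/measurable_EFinP; exact: mF.
  - move=> y _; rewrite lee_fin; case: ifP => // _; exact: fine_ge0.
  exists B; split => // y /= H.
  apply: contrapT => yB; apply: H => _.
  by rewrite memNset// fineK.
Qed.

(** * Measures on a product determined by rational rays *)

(** The rational endpoints match the rational indices of the conditional distribution functions. *)
Definition rat_ray {R : realType} (q : rat) : set R := `]ratr q, +oo[%classic.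

Lemma measurable_rat_rayE (R : realType) :
  @measurable _ R = <<s range (@rat_ray R) >>.
Proof.
rewrite [LHS](RGenOInfty.measurableE R) eqEsubset; split; last first.
  apply: smallest_sub; first exact: smallest_sigma_algebra.
  by move=> _ [q _ <-]; apply: sub_sigma_algebra; exists (ratr q).
apply: smallest_sub; first exact: smallest_sigma_algebra.
move=> _ [x ->].
have -> : `]x, +oo[%classic =
    \bigcup_q (if x <= ratr q then rat_ray q else set0) :> set R.
  apply/seteqP; split => y /=.
    rewrite in_itv/= andbT => /rat_in_itvoo[q]; rewrite in_itv/= => /andP[xq qy].
    by exists q => //; rewrite (ltW xq) /rat_ray/= in_itv/= qy.
  move=> [q _]; case: ifPn => // xq; rewrite /rat_ray/= !in_itv/= !andbT.
  exact: le_lt_trans.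
pose RT := g_sigma_algebraType (range (@rat_ray R)).
apply: (@bigcupT_measurable_rat _ RT) => q.
by case: ifPn => _; [apply: sub_sigma_algebra; exists q | exact: measurable0].
Qed.

Lemma cover_rat_ray (R : realType) :
  \bigcup_(k : nat) rat_ray (- k%:R) = [set: R].
Proof.
apply/seteqP; split => // x _; exists (Num.truncn `|x|).+1 => //.
rewrite /rat_ray/= in_itv/= andbT rmorphN/= ratr_nat ltrNl.
by rewrite (le_lt_trans (ler_norm _))// normrN truncnS_gt.
Qed.

(** A rectangle is the intersection of two cylinders. The subsets of the line whose cylinder is
    generated form a sigma-algebra containing the rays; a cylinder over a subset of [Y] is a
    countable union of generators, as the rays cover the line. *)
Lemma measurable_prod_rat_rayE d (Y : measurableType d) (R : realType) :
  @measurable _ (R * Y)%type =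
  <<s [set A `*` C | A in range (@rat_ray R) & C in @measurable _ Y] >>.
Proof.
set H := [set A `*` C | A in _ & C in _].
rewrite measurable_prod_measurableType eqEsubset; split; last first.
  apply: smallest_sub; first exact: smallest_sigma_algebra.
  move=> _ [_ [q _ <-]] [C mC <-]; apply: sub_sigma_algebra.
  by exists (rat_ray q); [exact: measurable_itv | exists C].
apply: smallest_sub; first exact: smallest_sigma_algebra.
move=> _ [A mA] [C mC <-].
have -> : A `*` C = (A `*` setT) `&` (setT `*` C) by rewrite -setXI setIT setTI.
pose HT := g_sigma_algebraType H.
apply: (@measurableI _ HT).
- move: mA; rewrite measurable_rat_rayE.
  suff : <<s range (@rat_ray R) >> `<=` [set B | <<s H>> (B `*` setT)] by exact.
  apply: smallest_sub => /=; last first.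
    move=> _ [q _ <-]; apply: sub_sigma_algebra.
    by exists (rat_ray q) => //; exists setT.
  split => /=.
  + by rewrite set0X; exact: (@measurable0 _ HT).
  + move=> B mB; rewrite setTD (_ : _ `*` _ = ~` (B `*` setT)).
      exact: (@measurableC _ HT).
    by apply/seteqP; split => -[x y] /=; tauto.
  + move=> F mF; rewrite setX_bigcupl.
    by apply: (@bigcupT_measurable _ HT) => i; exact: mF.
- rewrite -(cover_rat_ray R) setX_bigcupl; apply: (@bigcupT_measurable _ HT) => k.
  by apply: sub_sigma_algebra; exists (rat_ray (- k%:R)) => //; exists C.
Qed.

(** The generating rectangles are closed under intersection and countably many of them, of finite
    measure, cover the space, so measures that agree on them coincide. *)
Lemma eq_measure_rat_ray d (Y : measurableType d) (R : realType)
    (m1 m2 : {finite_measure set (R * Y)%type -> \bar R}) :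
  (forall q C, measurable C ->
    m1 (rat_ray q `*` C) = m2 (rat_ray q `*` C)) ->
  forall S, measurable S -> m1 S = m2 S.
Proof.
move=> m12; apply: (measure_unique _ (fun k => rat_ray (- k%:R) `*` setT)
  (measurable_prod_rat_rayE Y R)).
- move=> _ _ [_ [p _ <-] [C mC <-]] [_ [q _ <-] [D mD <-]].
  rewrite -setXI; exists (rat_ray (Num.max p q)) => //.
  exists (C `&` D); first exact: measurableI.
  congr (_ `*` _); apply/seteqP; split => x; rewrite /rat_ray/= !in_itv/= !andbT.
  by rewrite maxr_rat gt_max => /andP[].
  by rewrite maxr_rat gt_max => /andP.
- by move=> k; exists (rat_ray (- k%:R)) => //; exists setT.
- by rewrite -setX_bigcupl cover_rat_ray setXTT.
- by move=> _ [_ [q _ <-] [C mC <-]]; exact: m12.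
- move=> k; rewrite -ge0_fin_numE//; apply: fin_num_measure.
  by apply: measurableX => //; exact: measurable_itv.
Qed.

(** * Conditional quantiles *)

Lemma uniform01 (R : realType) : exists U : probability R R,
  forall a, 0 <= a <= 1 -> U `]a, +oo[%classic = (1 - a)%:E.
Proof.
(* The uniform law lives on the copy [TR] of the line; the identity carries it to [R]. *)
pose TR := measurableTypeR R.
have mid : measurable_fun setT (idfun : TR -> R) by exact: measurable_id.
exists (distribution (uniform_prob (@ltr01 R)) (mfun_of mid)) => a /andP[a0 a1].
transitivity (uniform_prob (@ltr01 R) (`]a, +oo[%classic : set TR)) => //.
have mA : measurable (`]a, +oo[%classic : set TR) by exact: measurable_itv.
have mI : measurable (`[0, 1]%classic : set TR) by exact: measurable_itv.
rewrite -(setIT `]a, +oo[%classic) -integral_indic//.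
rewrite integral_uniform//; last first.
  by apply/measurable_EFinP; exact: measurable_indic.
rewrite integral_indic//.
rewrite subr0 invr1 mul1e.
have -> : `]a, +oo[%classic `&` `[0, 1]%classic = `]a, 1]%classic :> set R;
  last first.
  rewrite [LHS](lebesgue_measure_itv `]a, 1])/= lte_fin.
  by case: ltgtP a1 => // -> _; rewrite subrr.
apply/seteqP; split => x /=; rewrite !in_itv/= andbT.
  by move=> [-> /andP[_ ->]].
by move=> /andP[ax x1]; rewrite ax x1 (ltW (le_lt_trans a0 ax)).
Qed.

(* The point 0 and the bound p <= 1 make this the supremum of a nonempty bounded
   set for every w, in particular for w.2 outside [0, 1]. *)
Definition quantile (R : realType) (Y : Type) (F : rat -> Y -> R)
    (w : Y * R) : R :=
  sup (0 |` [set ratr p | p in [set p : rat | p <= 1 /\ F p w.1 < w.2]]).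

Section quantile.
Context (R : realType) (Y : Type) (F : rat -> Y -> R).

Let D w : set R :=
  0 |` [set ratr p | p in [set p : rat | p <= 1 /\ F p w.1 < w.2]].

Let D_ub w : has_ubound (D w).
Proof.
exists 1 => x [->//|[p [p1 _] <-]].
by rewrite -(rmorph1 (@ratr R)) ler_rat.
Qed.

Lemma quantile_ge0 w : 0 <= quantile F w.
Proof. by apply: (ub_le_sup (D_ub w)); left. Qed.

(** A number lies below a supremum exactly when it lies below some element. For [t >= 0] that
    element is not the added point 0, so it comes from a rational [p]. *)
Lemma quantile_gtP w t : 0 <= t ->
  t < quantile F w <-> exists p, [/\ t < ratr p, p <= 1 & F p w.1 < w.2].
Proof.
move=> t0; split.
  move=> /sup_gt[|x [->|[p [p1 Fp] <-] tp]]; first by exists 0; left.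
    by rewrite ltNge t0.
  by exists p.
move=> [p [tp p1 Fp]]; apply: (lt_le_trans tp); apply: (ub_le_sup (D_ub w)).
by right; exists p.
Qed.

End quantile.

Lemma measurable_cdf_lt d (Y : measurableType d) (R : realType) (f : Y -> R) :
  measurable_fun setT f -> measurable [set w : Y * R | f w.1 < w.2].
Proof.
move=> mf.
have mlt : measurable_fun setT (fun w : Y * R => f w.1 < w.2).
  by apply: measurable_fun_ltr; [exact: measurableT_comp | exact: measurable_snd].
by rewrite -[X in measurable X]setTI; exact: (mlt measurableT [set true]).
Qed.

Lemma measurable_quantile d (Y : measurableType d) (R : realType)
    (F : rat -> Y -> R) :
  (forall p, measurable_fun setT (F p)) -> measurable_fun setT (quantile F).
Proof.
move=> mF; apply: (measurability _ (RGenOInfty.measurableE R)) => //.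
move=> _ [_ [t ->] <-]; rewrite setTI.
have [t0|t0] := ltP t 0.
  rewrite [X in measurable X](_ : _ = setT)//; apply/seteqP; split => // w _ /=.
  by rewrite in_itv/= andbT (lt_le_trans t0)// quantile_ge0.
rewrite [X in measurable X](_ : _ = \bigcup_p
  (if (t < ratr p) && (p <= 1) then [set w | F p w.1 < w.2] else set0)).
  apply: bigcupT_measurable_rat => p; case: ifP => // _.
  exact: measurable_cdf_lt.
apply/seteqP; split => w /=; rewrite in_itv/= andbT.
  by move=> /(quantile_gtP _ _ t0)[p [tp p1 Fp]]; exists p => //; rewrite tp p1.
move=> [p _]; case: ifP => // /andP[tp p1] Fp.
by apply/quantile_gtP => //; exists p.
Qed.

(** The sequence [t + (1 - t) / k.+1] starts at 1 and decreases to [t]. It serves to write the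
    events that a quantile or a variable exceeds [t] as increasing unions. *)
Lemma rat_approx_above (R : realType) (t : rat) : t < 1 ->
  exists p : nat -> rat, [/\ forall i j, (i <= j)%N -> p j <= p i,
    forall k, t < p k <= 1 &
    forall x : R, ratr t < x -> exists k, ratr (p k) < x].
Proof.
move=> t1; have t1' : 0 < 1 - t by rewrite subr_gt0.
exists (fun k => t + (1 - t) / k.+1%:R); split.
- by move=> i j ij; rewrite lerD2l ler_pM2l// lef_pV2 ?posrE// ler_nat.
- move=> k; rewrite ltrDl divr_gt0//= -lerBrDl ler_pdivrMr//.
  by rewrite ler_peMr ?(ltW t1')// ler1n.
- move=> x; rewrite -subr_gt0 => tx.
  exists (Num.truncn (ratr (1 - t) / (x - ratr t))).
  rewrite rmorphD/= -ltrBrDl fmorph_div/= ratr_nat ltr_pdivrMr//.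
  by rewrite mulrC -ltr_pdivrMr// truncnS_gt.
Qed.

(** Inverse transform sampling, conditionally on [pi]: [F p] is a version of the conditional
    probability of [X <= p] given [pi], and [q] is the generalized inverse of [F] evaluated at an
    independent uniform variable. *)
Lemma randomization d d' (T : measurableType d) (Y : measurableType d')
    (R : realType) (P : probability T R) (X : {mfun T >-> R})
    (pi : {mfun T >-> Y}) (U : probability R R) :
  (forall x, 0 <= X x <= 1) ->
  (forall a, 0 <= a <= 1 -> U `]a, +oo[%classic = (1 - a)%:E) ->
  exists q : {mfun (Y * R)%type >-> R}, forall S, measurable S ->
    (distribution P pi \x U)%E [set w | S (q w, w.1)] = P [set x | S (X x, pi x)].
Proof.
move=> X01 UE.
set mu := distribution P pi.
pose D p := X @^-1` `]-oo, ratr p].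
have mD p : measurable (D p) by exact: measurable_funPTI.
have Doo p : (P (D p) < +oo)%E by rewrite -ge0_fin_numE// fin_num_measure.
pose nu p : {finite_measure set Y -> \bar R} :=
  image_measure (mfrestr (mD p) (Doo p)) pi.
have nuE p A : nu p A = P ((pi @^-1` A) `&` D p) by [].
have [||F [mF F01 F_nd FE]] := @monotone_densities _ _ _ mu nu.
- move=> p q A pq mA; rewrite !nuE le_measure ?inE//.
  + apply: measurableI => //; exact: measurable_funPTI.
  + apply: measurableI => //; exact: measurable_funPTI.
  apply: setIS => x; rewrite /D/= !in_itv/= => /le_trans; apply.
  by rewrite ler_rat.
- move=> p A mA; rewrite nuE; apply: measureIl => //; exact: measurable_funPTI.
have mq := measurable_quantile mF.
exists (mfun_of mq).
pose V p : set (Y * R) := [set w | F p w.1 < w.2].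
have mV p : measurable (V p) by exact: measurable_cdf_lt.
have V_ni p r : p <= r -> V r `<=` V p.
  by move=> pr w; apply: le_lt_trans; exact: F_nd.
(* The section of [V p] at [y] is the ray above [F p y], of mass [1 - F p y]; integrating over [C]
   leaves the mass of [X > p] there. *)
have VE p C : measurable C ->
    (mu \x U)%E (V p `&` (C `*` setT)) = P ((pi @^-1` C) `&` X @^-1` rat_ray p).
  move=> mC; have mXr : measurable (X @^-1` rat_ray p).
    by apply: measurable_funPTI => //; exact: measurable_itv.
  have mpiC : measurable (pi @^-1` C) by exact: measurable_funPTI.
  have -> : (mu \x U)%E (V p `&` (C `*` setT)) =
      (\int[mu]_(y in C) ((1 - F p y)%:E))%E.
    rewrite /product_measure1 [RHS]integral_mkcond; apply: eq_integral => y _ /=.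
    rewrite patchE; case: ifPn => yC.
      rewrite -UE//; congr (U _); apply/seteqP; split => u.
        by rewrite /xsection/= inE /V/= in_itv/= andbT => -[].
      rewrite /xsection/= inE /V/= in_itv/= andbT => Fu; split => //.
      by split => //; exact: set_mem.
    rewrite (_ : xsection _ _ = set0) ?measure0//.
    apply/seteqP; split => u //; rewrite /xsection/= inE => -[_ [/= Cy _]].
    by move/negP: yC; apply; exact: mem_set.
  under eq_integral do rewrite EFinB.
  rewrite integralB//; last 2 first.
  - exact: finite_measure_integrable_cst.
  - apply: (@le_integrable _ _ _ mu C mC _ (cst 1%E)) => //;
      last exact: finite_measure_integrable_cst.
      by apply: measurable_funTS; apply/measurable_EFinP.
    move=> y _; rewrite lee_fin normr1.
    by have /andP[F0 F1] := F01 p y; rewrite ger0_norm.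
  rewrite integral_cst// mul1e -FE// nuE.
  transitivity (P (pi @^-1` C) - P (pi @^-1` C `&` D p))%E => //.
  rewrite [in LHS](measureDI P mpiC (mD p)).
  have -> : (pi @^-1` C) `\` D p = (pi @^-1` C) `&` X @^-1` rat_ray p.
    apply/seteqP; split => x; rewrite /D /rat_ray/= !in_itv/= andbT.
      by move=> [Cx /negP]; rewrite -ltNge.
    by move=> [Cx]; rewrite ltNge => /negP.
  by rewrite addeK// fin_num_measure//; exact: measurableI.
have mqU : measurable_fun setT (fun w => (quantile F w, w.1)).
  by apply/measurable_fun_pairP; split => //=; exact: measurable_fst.
have mXpi : measurable_fun setT (fun x => (X x, pi x)).
  by apply/measurable_fun_pairP; split => //=.
apply: (@eq_measure_rat_ray _ _ _ (distribution (mu \x U)%E (mfun_of mqU))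
  (distribution P (mfun_of mXpi))) => t C mC.
rewrite /distribution /pushforward/=.
have mpiC : measurable (pi @^-1` C) by exact: measurable_funPTI.
(* Both variables take values in [[0, 1]]: for [t >= 1] both events are empty, for [t < 0] both
   reduce to the condition [C]. *)
have [t1|t1] := leP 1 t.
  rewrite [X in _ X = _](_ : _ = set0); last first.
    apply/seteqP; split => // w [+ _]; rewrite /rat_ray/= in_itv/= andbT.
    have t0 : 0 <= ratr t :> R by rewrite ler0q (le_trans ler01).
    move=> /(quantile_gtP _ _ t0)[p [tp p1 _]].
    by move: tp; rewrite ltr_rat ltNge (le_trans p1 t1).
  rewrite [X in _ = P X](_ : _ = set0) ?measure0//.
  apply/seteqP; split => // x [+ _]; rewrite /rat_ray/= in_itv/= andbT.
  rewrite ltNge (le_trans (andP (X01 x)).2)//.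
  by rewrite -(rmorph1 (@ratr R)) ler_rat.
have [t0|t0] := ltP t 0.
  have t0' : ratr t < 0 :> R by rewrite ltrq0.
  rewrite [X in _ X = _](_ : _ = C `*` setT); last first.
    apply/seteqP; split => w [] //= w1 w2; split => //.
    by rewrite /rat_ray/= in_itv/= andbT (lt_le_trans t0')// quantile_ge0.
  rewrite product_measure1E// [X in (_ * X)%E](_ : _ = 1%E); last first.
    exact: probability_setT.
  rewrite mule1; congr (P _); apply/seteqP; split => x //=; last by move=> [].
  split => //; rewrite /rat_ray/= in_itv/= andbT (lt_le_trans t0')//.
  exact: (andP (X01 x)).1.
have t0' : 0 <= ratr t :> R by rewrite ler0q.
(* For [0 <= t < 1] both events are increasing unions along [p k], with terms of equal mass by [VE];
   continuity from below concludes. *)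
have [p [p_ni p_itv p_lim]] := @rat_approx_above R _ t1.
rewrite [X in _ X = _](_ : _ = \bigcup_k (V (p k) `&` (C `*` setT))); last first.
  apply/seteqP; split => w.
    move=> [+ Cw] /=; rewrite /rat_ray/= in_itv/= andbT.
    move=> /(quantile_gtP _ _ t0')[r [/p_lim[k pkr] r1 Fr]].
    exists k => //; split => //; apply: V_ni Fr.
    by move: pkr; rewrite ltr_rat => /ltW.
  move=> [k _ [Vw [/= Cw _]]]; split => //=.
  rewrite /rat_ray/= in_itv/= andbT; apply/(quantile_gtP _ _ t0').
  by exists (p k); have /andP[tp p1] := p_itv k; rewrite ltr_rat.
rewrite [X in _ = P X](_ : _ =
    \bigcup_k (pi @^-1` C `&` X @^-1` rat_ray (p k))); last first.
  apply/seteqP; split => x.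
    move=> [+ Cx] /=; rewrite /rat_ray/= in_itv/= andbT => /p_lim[k pX].
    by exists k => //; split => //; rewrite /= in_itv/= andbT.
  move=> [k _ [/= Cx +]]; rewrite /rat_ray/= !in_itv/= !andbT => pX; split => //=.
  rewrite (lt_trans _ pX)// ltr_rat.
  by have /andP[] := p_itv k.
have mA k : measurable (V (p k) `&` (C `*` setT)).
  by apply: measurableI => //; exact: measurableX.
have mB k : measurable (pi @^-1` C `&` X @^-1` rat_ray (p k)).
  apply: measurableI => //; apply: measurable_funPTI => //.
  exact: measurable_itv.
have AB : (mu \x U)%E \o (fun k => V (p k) `&` (C `*` setT)) =
    P \o (fun k => pi @^-1` C `&` X @^-1` rat_ray (p k)).
  by apply/funext => k /=; rewrite VE.
have := @nondecreasing_cvg_mu _ _ _ (mu \x U)%E _ mA (bigcupT_measurable _ mA).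
have := @nondecreasing_cvg_mu _ _ _ P _ mB (bigcupT_measurable _ mB).
rewrite AB => cvB cvA; apply: (cvg_unique _ (cvA _) (cvB _)) => //.
  by move=> i j ij; apply/subsetPset; apply: setSI; apply: V_ni; exact: p_ni.
move=> i j ij; apply/subsetPset; apply: setIS => x.
rewrite /rat_ray/= !in_itv/= !andbT; apply: le_lt_trans.
by rewrite ler_rat p_ni.
Qed.

(** * A standard Borel space as a measurable retract of the real line *)

Lemma measurable_natr_bool d (T : measurableType d) (R : realType) (D : set T)
    (f : T -> bool) :
  measurable [set x | f x] -> measurable_fun D (fun x => (f x)%:R : R).
Proof.
move=> mf; rewrite (_ : (fun _ => _) = \1_[set x | f x]).
  exact: measurable_indic.
apply/funext => x; rewrite indicE; congr (nat_of_bool _)%:R.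
by apply/idP/idP; rewrite inE.
Qed.

(* The digits are 0 and 2, so that comparing with 1/2 recovers the first digit:
   the remaining ones contribute at most 1/3. *)
Section ternary.
Context {R : realType}.
Implicit Types (b : nat -> bool) (t : R).

(** Horner form of the partial sums of [2 * b i / 3 ^ i.+1]: peeling off the first digit exposes the
    shift of the sequence. *)
Fixpoint ternary_sum (n : nat) b : R :=
  if n is m.+1 then (2 * (b 0%N)%:R + ternary_sum m (b \o S)) / 3 else 0.

Lemma ternary_sum_bounds n b : 0 <= ternary_sum n b <= 1.
Proof.
elim: n b => [|n IHn] b /=; first by rewrite lexx ler01.
have /andP[] := IHn (b \o S).
by case: (b 0%N) => /= s0 s1; apply/andP; split; lra.
Qed.

Lemma ternary_sum_nd b : {homo ternary_sum^~ b : n m / (n <= m)%N >-> n <= m}.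
Proof.
apply/nondecreasing_seqP => n.
elim: n b => [|n IHn] b; first by have /andP[] := ternary_sum_bounds 1 b.
rewrite [leLHS]/= [leRHS]/= ler_pM2r ?invr_gt0// lerD2l.
exact: IHn.
Qed.

Definition ternary b : R := limn (ternary_sum^~ b).

Lemma cvg_ternary b : ternary_sum n b @[n --> \oo] --> ternary b.
Proof.
apply: nondecreasing_is_cvgn; first exact: ternary_sum_nd.
by exists 1 => _ [n _ <-]; have /andP[] := ternary_sum_bounds n b.
Qed.

Lemma ternary_bounds b : 0 <= ternary b <= 1.
Proof.
apply/andP; split.
  apply: limr_ge; first by apply/cvg_ex; eexists; exact: cvg_ternary.
  by apply: nearW => n; have /andP[] := ternary_sum_bounds n b.
apply: limr_le; first by apply/cvg_ex; eexists; exact: cvg_ternary.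
by apply: nearW => n; have /andP[] := ternary_sum_bounds n b.
Qed.

Lemma ternaryE b : ternary b = (2 * (b 0%N)%:R + ternary (b \o S)) / 3.
Proof.
have h1 : ternary_sum n.+1 b @[n --> \oo] --> ternary b.
  by rewrite (cvg_shiftS (fun n => ternary_sum n b)); exact: cvg_ternary.
apply: (cvg_unique _ h1) => //=.
apply: cvgMl; apply: cvgD; first exact: cvg_cst.
exact: cvg_ternary.
Qed.

(** On the range of [ternary] this deletes the first digit, which is read off by the comparison with
    1/2. *)
Definition ternary_shift t : R := 3 * t - 2 * (2^-1 < t)%R%:R.

Definition ternary_bit t (i : nat) : bool := 2^-1 < iter i ternary_shift t.

Lemma ternary_gt_half b : (2^-1 < ternary b) = b 0%N.
Proof.
rewrite ternaryE; have /andP[] := ternary_bounds (b \o S).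
by case: (b 0%N) => /= s0 s1; [apply/idP | apply/negbTE; rewrite -leNgt]; lra.
Qed.

Lemma ternary_shiftE b : ternary_shift (ternary b) = ternary (b \o S).
Proof. by rewrite /ternary_shift ternary_gt_half [in LHS]ternaryE; field. Qed.

Lemma ternary_bitK b : ternary_bit (ternary b) =1 b.
Proof.
move=> i; rewrite /ternary_bit; elim: i b => [|i IHi] b.
  by rewrite /= ternary_gt_half.
by rewrite iterSr ternary_shiftE IHi.
Qed.

Lemma measurable_ternary_bit i : measurable [set t | ternary_bit t i].
Proof.
have m_shift : measurable_fun setT ternary_shift.
  apply: measurable_funB; apply: measurable_funM => //.
  apply: measurable_natr_bool.
  rewrite (_ : [set _ | _] = `]2^-1, +oo[%classic); first exact: measurable_itv.
  by apply/seteqP; split => x /=; rewrite in_itv/= andbT.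
have m_iter : measurable_fun setT (iter i ternary_shift).
  elim: i => [|i IHi] /=; first exact: measurable_id.
  exact: measurableT_comp m_shift IHi.
rewrite (_ : [set _ | _] = iter i ternary_shift @^-1` `]2^-1, +oo[%classic).
  by rewrite -[X in measurable X]setTI; apply: m_iter.
by apply/seteqP; split => x /=; rewrite in_itv/= andbT.
Qed.

Lemma measurable_fun_ternary d (T : measurableType d) (b : T -> nat -> bool) :
  (forall i, measurable [set x | b x i]) ->
  measurable_fun setT (fun x => ternary (b x)).
Proof.
move=> mb; apply: (@measurable_fun_cvg _ _ _ _ (fun n x => ternary_sum n (b x))).
  move=> n; elim: n b mb => [|n IHn] b mb /=; first exact: measurable_cst.
  apply: measurable_funM => //; apply: measurable_funD.
    apply: measurable_funM => //.
    by apply: measurable_natr_bool; exact: mb.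
  by apply: (IHn (fun x => b x \o S)) => i; exact: mb.
by move=> x _; exact: cvg_ternary.
Qed.
End ternary.

(** * Metric spaces: dense sequences and limits with a rate *)

Lemma open_metric_ball (R : realType) (X : metricType R) (x : X) (eps : R) :
  open (ball x eps).
Proof.
rewrite openE => y; rewrite ballEmdist/= => xy.
apply/nbhs_ballP; exists (eps - mdist x y); first by rewrite /= subr_gt0.
move=> z; rewrite !ballEmdist/= => yz.
rewrite (le_lt_trans (metric_triangle x y z))//.
by rewrite addrC -ltrBrDr.
Qed.

Lemma invS_lt (R : realType) (eps : R) : 0 < eps ->
  exists k : nat, k.+1%:R^-1 < eps.
Proof.
move=> e0; exists (Num.truncn eps^-1).
by rewrite -[ltRHS]invrK ltf_pV2 ?posrE ?invr_gt0// truncnS_gt.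
Qed.

Section polish.
Context {R : realType} {X : metricType R}.
Let r (k : nat) : R := k.+1%:R^-1.

Let r_gt0 k : 0 < r k. Proof. by rewrite invr_gt0. Qed.

(** Numbers outside the range of the injection [h] get the default [x0], which does no harm as only
    the existence of a close index is asserted. *)
Lemma countable_dense_seq (D : set X) (x0 : X) : countable D -> dense D ->
  exists e : nat -> X, forall x (eps : R), 0 < eps ->
    exists n, mdist x (e n) < eps.
Proof.
move=> /countable_injP[h h_inj] dD.
exists (fun n => xget x0 [set x | D x /\ h x = n]) => x eps e0.
have [|y [xy Dy]] := dD _ _ (open_metric_ball x eps).
  by exists x; exact: ballxx.
exists (h y); case: xgetP => [z _ [Dz hzy]|/(_ y)]; last by case.
have -> : z = y by apply: h_inj => //; rewrite inE.
by move: xy; rewrite ballEmdist.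
Qed.

(** Letting [k] grow removes the error [r k] from the bound. With [y := e n] and [c := r k] this
    makes the limit respect every digit that is set. *)
Lemma cauchy_rate_limit (x_ : nat -> X) :
  (forall F : set_system X, ProperFilter F -> cauchy F ->
    exists x : X, F --> x) ->
  (forall j k, mdist (x_ j) (x_ k) < r j + r k) ->
  exists z, forall y c, (forall k, mdist y (x_ k) < c + r k) -> mdist y z <= c.
Proof.
move=> X_complete x_r.
have [|z xz] := X_complete (x_ @ \oo) _.
  apply: cauchy_exP => eps e0; have [j rj] := invS_lt (divr_gt0 e0 (ltr0Sn _ 1)).
  exists (x_ j).
  change (\forall k \near \oo, ball (x_ j) eps (x_ k)).
  near=> k; rewrite ballEmdist/= (lt_le_trans (x_r _ _))//.
  rewrite [leRHS]splitr lerD//; first exact: ltW.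
  rewrite ltW//; near: k.
  exact: (near_infty_natSinv_lt (PosNum (divr_gt0 e0 (ltr0Sn _ 1)))).
exists z => y c yc; apply/ler_addgt0Pr => eps e0.
have e20 : 0 < eps / 2 by rewrite divr_gt0.
have [k [xk rk]] : exists k, mdist z (x_ k) < eps / 2 /\ r k < eps / 2.
  have := near_infty_natSinv_lt (PosNum e20).
  move/cvg_ballP : xz => /(_ _ e20) xz rz.
  have [k []] := @filter_ex _ _ _ _ (filterI xz rz).
  by rewrite ballEmdist; exists k.
rewrite (le_trans (metric_triangle y (x_ k) z))// (metric_sym _ z).
have := yc k; lra.
Unshelve. all: by end_near. Qed.

End polish.

(** A point of [X] is determined by which [e n] lie within [r k] of it. The map [phi] writes these
    answers as ternary digits, and [psi] recovers the point from them by completeness. *)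
Lemma standard_borel_retract (R : realType) d (T : measurableType d) :
  standard_borel R T ->
  exists (phi : {mfun T >-> R}) (psi : {mfun R >-> T}),
    (forall x, 0 <= phi x <= 1) /\ cancel phi psi.
Proof.
move=> [X [f [[[D cD dD] X_complete] [g fK gK] fM]]].
have [e eP] := countable_dense_seq (f point) cD dD.
pose r (k : nat) : R := k.+1%:R^-1.
have r_gt0 k : 0 < r k by rewrite invr_gt0.
(* There is one digit for each pair [(k, n)]; an index that codes no pair gets the digit 0. *)
pose b x i :=
  if unpickle i is Some (k, n) then mdist (f x) (e n) < r k else false.
have mb i : measurable [set x | b x i].
  rewrite /b; case: unpickle => [[k n]|]; last first.
    by rewrite (_ : [set _ | _] = set0) ?measurable0//; apply/seteqP; split.
  rewrite (_ : [set _ | _] = f @^-1` ball (e n) (r k)).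
    by apply/fM; apply: sub_sigma_algebra; exact: open_metric_ball.
  by apply/seteqP; split => x; rewrite ballEmdist/= (metric_sym (f x)).
pose phi := ternary \o b : T -> R.
have mphi : measurable_fun setT phi by exact: measurable_fun_ternary.
pose bit (t : R) (k n : nat) := ternary_bit t (pickle (k, n)).
have bit_phi x k n : bit (phi x) k n = (mdist (f x) (e n) < r k).
  by rewrite /bit ternary_bitK /b pickleK.
(* The range of phi is not visibly measurable; good is a measurable set that
   contains it and on which the digits still determine a point of X. *)
pose good t := (forall k, exists n, bit t k n) /\
  (forall k n k' n', bit t k n -> bit t k' n' -> mdist (e n) (e n') < r k + r k').
pose approx t z := forall k n, bit t k n -> mdist (e n) z <= r k.
(* A fixed value off [good] keeps the preimages under [psiX] measurable there. *)
have psi_ex t : exists z, (good t -> approx t z) /\ (~ good t -> z = f point).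
  have [gt|gt] := pselect (good t); last by exists (f point).
  have /choice[m mP] := gt.1.
  have [|z zP] := cauchy_rate_limit (x_ := e \o m) X_complete.
    by move=> j k; exact: gt.2.
  by exists z; split => // _ k n tkn; apply: zP => j; exact: gt.2.
have /choice[psiX psiP] := psi_ex.
have approx_uniq t z z' : good t -> approx t z -> approx t z' -> z = z'.
  move=> [g1 _] az az'; apply: mdist_positivity; apply/eqP.
  rewrite eq_le mdist_ge0 andbT; apply/ler_addgt0Pr => eps e0; rewrite add0r.
  have [k rk] : exists k, r k < eps / 2 by apply: invS_lt; rewrite divr_gt0.
  have [n tkn] := g1 k.
  rewrite (le_trans (metric_triangle z (e n) z'))// metric_sym.
  have := az _ _ tkn; have := az' _ _ tkn; lra.
have good_phi x : good (phi x).
  split => [k|k n k' n'].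
    by have [n] := eP (f x) _ (r_gt0 k); exists n; rewrite bit_phi.
  rewrite !bit_phi => h h'; rewrite (le_lt_trans (metric_triangle _ (f x) _))//.
  by rewrite ltrD// metric_sym.
have psiXK x : psiX (phi x) = f x.
  apply: (approx_uniq (phi x)) => //; first exact: (psiP _).1.
  by move=> k n; rewrite bit_phi metric_sym => /ltW.
have mbit k n : measurable [set t | bit t k n] by exact: measurable_ternary_bit.
pose S k n := [set t | bit t k n].
pose close k n k' n' := mdist (e n) (e n') < r k + r k'.
have mgood : measurable good.
  rewrite (_ : good = \bigcap_k \bigcup_n S k n `&` \bigcap_k \bigcap_n
      \bigcap_k' \bigcap_n' (if close k n k' n' then setT
                              else ~` (S k n `&` S k' n'))).
    apply: measurableI.
      apply: bigcapT_measurable => k.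
      by apply: bigcupT_measurable => n; exact: mbit.
    do 4!(apply: bigcapT_measurable => ?); case: ifP => // _.
    by apply: measurableC; apply: measurableI; exact: mbit.
  apply/seteqP; split => t.
    move=> [t1 t2]; split => [k _|k _ n _ k' _ n' _].
      by have [n tkn] := t1 k; exists n.
    by case: ifPn => // /negP nc [tkn tkn']; apply: nc; exact: t2.
  move=> [t1 t2]; split => [k|k n k' n' tkn tkn'].
    by have [n _ tkn] := t1 k I; exists n.
  have := t2 k I n I k' I n' I; rewrite -/(close k n k' n').
  by case: ifP => // _ [].
have mpsi_open U : open U -> measurable (psiX @^-1` U).
  move=> oU.
  (* For [t] in [good], [psiX t] lies in [U] exactly when some digit [(k, n)] of [t] is set whose
     closed ball of radius [r k] about [e n] is contained in [U]. *)
  pose inU k n := `[< forall z, mdist (e n) z <= r k -> U z >].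
  rewrite (_ : _ @^-1` _ =
      (good `&` \bigcup_k \bigcup_n (if inU k n then S k n else set0)) `|`
      (if `[< U (f point) >] then ~` good else set0)).
    apply: measurableU; last by case: ifP => _ //; exact: measurableC.
    apply: measurableI => //; do 2!(apply: bigcupT_measurable => ?).
    by case: ifP => _ //; exact: mbit.
  apply/seteqP; split => t /=.
    have [gt Ut|gt Ut] := pselect (good t); last first.
      by right; rewrite -((psiP t).2 gt) asboolT.
    left; split => //.
    have : nbhs (psiX t) U by exact: open_nbhs_nbhs.
    move=> /nbhs_ballP[eps /= e0 epsU].
    have [k rk] : exists k, r k < eps / 2 by apply: invS_lt; rewrite divr_gt0.
    have [n tkn] := gt.1 k; exists k => //; exists n => //.
    rewrite /inU asboolT// => z ez; apply: epsU; rewrite ballEmdist/=.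
    rewrite (le_lt_trans (metric_triangle _ (e n) _))// metric_sym.
    have := (psiP t).1 gt k n tkn; lra.
  move=> [[gt [k _ [n _]]]|].
    by case: ifP => // /asboolP kU tkn; apply: kU; exact: (psiP t).1.
  by case: ifP => // /asboolP Uf gt; rewrite ((psiP t).2 gt).
have mpsi : measurable_fun setT (g \o psiX).
  move=> _ A mA; rewrite setTI.
  have : <<s @open X >> (g @^-1` A).
    apply/fM; rewrite -comp_preimage (_ : g \o f = id) ?preimage_id//.
    by apply/funext => x /=; rewrite fK.
  suff : <<s @open X >> `<=` [set B | measurable (psiX @^-1` B)] by exact.
  apply: smallest_sub => //=; split => /=.
  - by rewrite preimage_set0.
  - by move=> B mB; rewrite setTD preimage_setC; exact: measurableC.
  - by move=> F mF; rewrite preimage_bigcup; exact: bigcupT_measurable.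
exists (mfun_of mphi), (mfun_of mpsi); split.
  by move=> x; exact: ternary_bounds.
by move=> x; rewrite /= psiXK fK.
Qed.

(** * Couplings *)

(** The real code [phi] is randomized, then decoded by [psi]; since [psi] undoes [phi], the joint
    law with [pi] is that of the original point. *)
Lemma noise_outsourcing (R : realType) d d' (T : measurableType d)
    (Y : measurableType d') (P : probability T R) (pi : {mfun T >-> Y})
    (U : probability R R) :
  standard_borel R T ->
  (forall a, 0 <= a <= 1 -> U `]a, +oo[%classic = (1 - a)%:E) ->
  exists g : {mfun (Y * R)%type >-> T}, forall S, measurable S ->
    (distribution P pi \x U)%E [set w | S (g w, w.1)] = P [set x | S (x, pi x)].
Proof.
move=> /standard_borel_retract[phi [psi [phi01 phiK]]] UE.
have [q qP] := randomization P pi phi01 UE.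
have mg : measurable_fun setT (psi \o q) by exact: measurableT_comp.
exists (mfun_of mg) => S mS.
have mpsi : measurable_fun setT (fun w : R * Y => (psi w.1, w.2)).
  apply/measurable_fun_pairP; split => /=; last exact: measurable_snd.
  exact: (measurableT_comp (measurable_funP psi) measurable_fst).
have mS' : measurable [set w : R * Y | S (psi w.1, w.2)].
  by rewrite -[X in measurable X]setTI; exact: mpsi.
rewrite (qP _ mS')/=; congr (P _).
by apply/seteqP; split => x /=; rewrite phiK.
Qed.

Lemma measurable_preimage d d' (T : measurableType d) (Y : measurableType d')
    (f : T -> Y) (S : set Y) : measurable_fun setT f -> measurable S ->
  measurable (f @^-1` S).
Proof. by move=> mf mS; rewrite -[X in measurable X]setTI; exact: mf. Qed.

(** In the application [E], [E1] and [EY] are one relation, read with the sigma-algebras of three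
    different products. *)
Lemma lift_coupling (R : realType) d d' (T : measurableType d)
    (Y : measurableType d') (pi : {mfun T >-> Y}) (P P' : probability T R)
    (L : probability (Y * Y)%type R) :
  standard_borel R T ->
  couplings (distribution P pi) (distribution P' pi) L ->
  exists2 Q, couplings P P' Q &
    forall (E : set (T * T)) (E1 : set (T * Y)) (EY : set (Y * Y)),
      measurable E -> measurable E1 -> measurable EY ->
      (forall x, E1 (x, pi x)) ->
      (forall x x' y y', E1 (x, y) -> E1 (x', y') -> EY (y, y') -> E (x, x')) ->
      (Q (~` E) <= L (~` EY))%E.
Proof.
move=> TB LP.
have [U UE] := uniform01 R.
have [g gP] := noise_outsourcing P pi TB UE.
have [g' g'P] := noise_outsourcing P' pi TB UE.
(* [M] is the law of [(y, y', u, v)], with [(y, y')] of law [L] and [u], [v] independent uniform;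
   [p1] picks [(y, u)] and [p2] picks [(y', v)]. *)
pose M := ((L \x U) \x U)%E.
pose p1 (w : (Y * Y) * R * R) := (w.1.1.1, w.1.2).
pose p2 (w : (Y * Y) * R * R) := (w.1.1.2, w.2).
have mp1 : measurable_fun setT p1.
  apply/measurable_fun_pairP; split; last first.
    exact: (measurableT_comp measurable_snd measurable_fst).
  exact: (measurableT_comp measurable_fst
    (measurableT_comp measurable_fst measurable_fst)).
have mp2 : measurable_fun setT p2.
  apply/measurable_fun_pairP; split; last exact: measurable_snd.
  exact: (measurableT_comp measurable_snd
    (measurableT_comp measurable_fst measurable_fst)).
have U1 : U setT = 1%E by exact: probability_setT.
(* On rectangles the first marginal of [L] appears, and uniqueness of the product measure does the
   rest. *)
have p1P S : measurable S -> M (p1 @^-1` S) = (distribution P pi \x U)%E S.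
  move=> mS; apply/esym.
  apply: (@product_measure_unique _ _ _ _ _ _ _
    (distribution M (mfun_of mp1))) => //.
  move=> A B mA mB; rewrite /distribution /pushforward/=.
  transitivity (M (((A `*` setT) `*` B) `*` setT)).
    by congr (M _); apply/seteqP; split => w /=; rewrite /p1/=; tauto.
  rewrite /M product_measure1E//; last by do !apply: measurableX.
  rewrite [X in (X * _)%E]product_measure1E//; last exact: measurableX.
  rewrite [X in (_ * X)%E]U1 mule1; congr (_ * _)%E.
  have [+ _] := LP A mA; rewrite /pushforward => <-; congr (L _).
  by apply/seteqP; split => w /=; tauto.
have p2P S : measurable S -> M (p2 @^-1` S) = (distribution P' pi \x U)%E S.
  move=> mS; apply/esym.
  apply: (@product_measure_unique _ _ _ _ _ _ _
    (distribution M (mfun_of mp2))) => //.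
  move=> A B mA mB; rewrite /distribution /pushforward/=.
  transitivity (M (((setT `*` A) `*` setT) `*` B)).
    by congr (M _); apply/seteqP; split => w /=; rewrite /p2/=; tauto.
  rewrite /M product_measure1E//; last by do !apply: measurableX.
  rewrite [X in (X * _)%E]product_measure1E//; last exact: measurableX.
  rewrite [X in (_ * X * _)%E]U1 mule1; congr (_ * _)%E.
  have [_] := LP A mA; rewrite /pushforward => <-; congr (L _).
  by apply/seteqP; split => w /=; tauto.
have mh : measurable_fun setT (fun w => (g (p1 w), g' (p2 w))).
  apply/measurable_fun_pairP; split.
    exact: (measurableT_comp (measurable_funP g) mp1).
  exact: (measurableT_comp (measurable_funP g') mp2).
exists (distribution M (mfun_of mh)).
  move=> A mA; rewrite /pushforward/= /distribution/= /pushforward/=.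
  split.
  - transitivity (M (p1 @^-1` (g @^-1` A))) => //.
    rewrite p1P//; last exact: measurable_funPTI.
    transitivity ((distribution P pi \x U)%E [set w | (A `*` setT) (g w, w.1)]).
      by congr (product_measure1 _ _ _); apply/seteqP; split => w /=; tauto.
    rewrite gP; last exact: measurableX.
    by congr (P _); apply/seteqP; split => w /=; tauto.
  - transitivity (M (p2 @^-1` (g' @^-1` A))) => //.
    rewrite p2P//; last exact: measurable_funPTI.
    transitivity ((distribution P' pi \x U)%E [set w | (A `*` setT) (g' w, w.1)]).
      by congr (product_measure1 _ _ _); apply/seteqP; split => w /=; tauto.
    rewrite g'P; last exact: measurableX.
    by congr (P' _); apply/seteqP; split => w /=; tauto.
move=> E E1 EY mE mE1 mEY E1pi E1E.
(* If [E] fails, then so does one of the three links. The failures [B1] and [B2] are null because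
   [E1] holds at every [(x, pi x)], and [B3] has the mass of the complement of [EY]. *)
pose B1 := [set w | (~` E1) (g w, w.1)].
pose B2 := [set w | (~` E1) (g' w, w.1)].
pose B3 : set (Y * Y * R * R) := (~` EY `*` setT) `*` setT.
have mB1 : measurable B1.
  apply: (@measurable_preimage _ _ _ _ (fun w => (g w, w.1)) (~` E1)).
    by apply/measurable_fun_pairP; split => //=; exact: measurable_fst.
  exact: measurableC.
have mB2 : measurable B2.
  apply: (@measurable_preimage _ _ _ _ (fun w => (g' w, w.1)) (~` E1)).
    by apply/measurable_fun_pairP; split => //=; exact: measurable_fst.
  exact: measurableC.
have mB3 : measurable B3.
  by apply: measurableX => //; apply: measurableX => //; exact: measurableC.
have mp1B1 : measurable (p1 @^-1` B1) by exact: measurable_preimage.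
have mp2B2 : measurable (p2 @^-1` B2) by exact: measurable_preimage.
have MB1 : M (p1 @^-1` B1) = 0%E.
  rewrite p1P// gP; last exact: measurableC.
  rewrite [X in P X](_ : _ = set0) ?measure0//.
  by apply/seteqP; split => // x; apply; exact: E1pi.
have MB2 : M (p2 @^-1` B2) = 0%E.
  rewrite p2P// g'P; last exact: measurableC.
  rewrite [X in P' X](_ : _ = set0) ?measure0//.
  by apply/seteqP; split => // x; apply; exact: E1pi.
have MB3 : M B3 = L (~` EY).
  rewrite /M product_measure1E//; last first.
    by apply: measurableX => //; exact: measurableC.
  rewrite [X in (X * _)%E]product_measure1E//; last exact: measurableC.
  by rewrite [X in (_ * X * _)%E]U1 [X in (_ * X)%E]U1 !mule1.
rewrite -MB3; apply: (@le_trans _ _ (M (p1 @^-1` B1 `|` p2 @^-1` B2 `|` B3))).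
  apply: (@le_measure _ _ _ ((L \x U) \x U)%E
    ((fun w => (g (p1 w), g' (p2 w))) @^-1` (~` E))); rewrite ?inE.
  - by apply: measurable_preimage => //; exact: measurableC.
  - by do !apply: measurableU.
  move=> w /= nE; apply: contrapT => /not_orP[/not_orP[nB1 nB2] nB3].
  apply: nE; apply: (E1E _ _ w.1.1.1 w.1.1.2).
  - exact: contrapT nB1.
  - exact: contrapT nB2.
  - apply: contrapT => nEY; apply: nB3; split => //; split => //.
    by case: w.1.1 nEY.
apply: (le_trans (@measureU2 _ _ _ ((L \x U) \x U)%E _ _ _ _)) => //.
  exact: measurableU.
rewrite -[leRHS]add0e leeD2r//.
rewrite (le_trans (@measureU2 _ _ _ ((L \x U) \x U)%E _ _ _ _))//.
by rewrite [X in (X + _)%E]MB1 [X in (_ + X)%E]MB2 adde0.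
Qed.

(** * Maximal coupling of two probability measures *)

Lemma hahn_difference d (Y : measurableType d) (R : realType)
    (mu mu' : probability Y R) :
  exists (A : set Y) (mup mun : {finite_measure set Y -> \bar R}), measurable A /\
    forall C, measurable C ->
      mup C = (mu (C `&` A) - mu' (C `&` A))%E /\
      mun C = (mu' (C `&` ~` A) - mu (C `&` ~` A))%E.
Proof.
pose nu : {charge set Y -> \bar R} :=
  cadd (charge_of_finite_measure mu) (copp (charge_of_finite_measure mu')).
have [A [N nuAN]] := Hahn_decomposition nu.
have [[mA _] [mN _] AN AN0] := nuAN.
have NE : N = ~` A.
  apply/seteqP; split => y.
    by move=> Ny Ay; have : (A `&` N) y by []; rewrite AN0.
  by move=> nAy; have : (A `|` N) y by [rewrite AN]; case.
exists A, (jordan_pos nuAN), (jordan_neg nuAN); split => // C mC.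
have fin (m : probability Y R) D : measurable D -> m D \is a fin_num.
  by move=> mD; exact: fin_num_measure.
split.
  by rewrite [LHS]jordan_posE cjordan_posE /crestr0 mem_set.
rewrite [LHS]jordan_negE cjordan_negE /crestr0 mem_set//.
rewrite /crestr/= /cadd/= /copp/= NE /charge_of_finite_measure.
rewrite fin_num_oppeB ?fin// 1?addeC//.
by apply: measurableI => //; rewrite -NE.
Qed.

(** The common part, [mu] off [A] and [mu'] on [A], goes to the diagonal as [k1] and [k2]. The
    excesses [mup] and [mun] have the same mass [c], and their product divided by [c] supplies the
    missing marginals at a cost of only [c] off the diagonal. *)
Lemma maximal_coupling d (Y : measurableType d) (R : realType)
    (mu mu' : probability Y R) :
  exists (L : probability (Y * Y)%type R) (A : set Y), [/\ measurable A,
    forall C, measurable C -> L (C `*` setT) = mu C,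
    forall C, measurable C -> L (setT `*` C) = mu' C &
    forall S, measurable S -> (forall y, S (y, y)) ->
      (L (~` S) <= mu A - mu' A)%E].
Proof.
have [A [mup [mun [mA mupnE]]]] := hahn_difference mu mu'.
have mAc : measurable (~` A) by exact: measurableC.
have finoo (m : probability Y R) D : measurable D -> (m D < +oo)%E.
  by move=> mD; rewrite -ge0_fin_numE// fin_num_measure.
have mdiag : measurable_fun setT (fun y : Y => (y, y)).
  by apply/measurable_fun_pairP; split => //=; exact: measurable_id.
pose diag := mfun_of mdiag.
pose k1 := image_measure (mfrestr mAc (finoo mu _ mAc)) diag.
pose k2 := image_measure (mfrestr mA (finoo mu' _ mA)) diag.
(* If mu = mu' then c = 0 and c^-1 = 0, which is harmless as mup = 0. *)
pose c := fine (mup setT).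
have c_ge0 : 0 <= c^-1 by rewrite invr_ge0 fine_ge0.
pose L : {measure set (Y * Y) -> \bar R} :=
  measure_add (measure_add k1 k2) (mscale (NngNum c_ge0) (mup \x mun)%E).
have LE S : L S = (mu ([set y | S (y, y)] `&` ~` A) +
    mu' ([set y | S (y, y)] `&` A) + c^-1%:E * (mup \x mun) S)%E.
  rewrite [LHS]measure_addE; congr (_ + _)%E; exact: measure_addE.
have finE (m : {finite_measure set Y -> \bar R}) D :
  measurable D -> m D = (fine (m D))%:E.
  by move=> mD; rewrite fineK// fin_num_measure.
have splitA (m : probability Y R) D : measurable D ->
    fine (m D) = fine (m (D `&` A)) + fine (m (D `&` ~` A)).
  move=> mD; apply: EFin_inj; rewrite EFinD -!finE//; [|exact: measurableI..].
  by rewrite addeC -setDE; exact: measureDI.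
have mupE D : measurable D ->
    fine (mup D) = fine (mu (D `&` A)) - fine (mu' (D `&` A)).
  move=> mD; apply: EFin_inj; rewrite EFinB -!finE//; [|exact: measurableI..].
  exact: (mupnE D mD).1.
have munE D : measurable D ->
    fine (mun D) = fine (mu' (D `&` ~` A)) - fine (mu (D `&` ~` A)).
  move=> mD; apply: EFin_inj; rewrite EFinB -!finE//; [|exact: measurableI..].
  exact: (mupnE D mD).2.
(* The two excesses balance because [mu] and [mu'] have the same total mass. *)
have cE : fine (mun setT) = c.
  have p1 (m : probability Y R) : fine (m setT) = 1.
    by rewrite probability_setT.
  rewrite /c munE// mupE//.
  by move: (splitA mu _ measurableT) (splitA mu' _ measurableT); rewrite !p1; lra.
have scaleK (m : {finite_measure set Y -> \bar R}) D : measurable D ->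
    fine (m setT) = c -> c^-1 * (fine (m D) * c) = fine (m D).
  move=> mD mc; have [c0|c0] := eqVneq c 0; last by field.
  rewrite c0 invr0 mul0r; apply/eqP; rewrite eq_le fine_ge0//=.
  by rewrite -[leRHS]c0 -mc fine_le ?fin_num_measure// le_measure// inE.
have prodE C D : measurable C -> measurable D ->
    (mup \x mun)%E (C `*` D) = (fine (mup C) * fine (mun D))%:E.
  move=> mC mD; rewrite product_measure1E// EFinM.
  by congr (_ * _)%E; exact: finE.
have L1 C : measurable C -> L (C `*` setT) = mu C.
  move=> mC; rewrite LE prodE//.
  have -> : [set y | (C `*` setT) (y, y)] = C.
    by apply/seteqP; split => y /=; tauto.
  rewrite (finE mu)//; last exact: measurableI.
  rewrite (finE mu')//; last exact: measurableI.
  rewrite (finE mu C)// cE -EFinM -!EFinD.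
  by rewrite scaleK// mupE// (splitA mu C)//; congr EFin; ring.
have L2 C : measurable C -> L (setT `*` C) = mu' C.
  move=> mC; rewrite LE prodE//.
  have -> : [set y | (setT `*` C) (y, y)] = C.
    by apply/seteqP; split => y /=; tauto.
  rewrite (finE mu)//; last exact: measurableI.
  rewrite (finE mu')//; last exact: measurableI.
  rewrite (finE mu' C)// -EFinM -!EFinD.
  rewrite -/c [c * _]mulrC.
  by rewrite scaleK// munE// (splitA mu' C)//; congr EFin; ring.
have LT : L setT = 1%E by rewrite -setXTT L1// probability_setT.
pose LP : probability (Y * Y)%type R :=
  HB.pack (Measure.sort L) (Measure_isProbability.Build _ _ _ L LT).
exists LP, A; split => // S mS Sdiag.
change (L (~` S) <= mu A - mu' A)%E; rewrite LE.
have -> : [set y | (~` S) (y, y)] = set0.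
  by apply/seteqP; split => // y; apply; exact: Sdiag.
rewrite !set0I !measure0 !add0e.
apply: (@le_trans _ _ (c^-1%:E * (mup \x mun) (setT `*` setT))%E).
  rewrite lee_wpmul2l ?lee_fin// le_measure// inE; first exact: measurableC.
  by rewrite setXTT.
rewrite prodE// cE -EFinM scaleK// mupE// !setTI EFinB -!finE//.
Qed.

(** On [E] the two coordinates lie in [A] together, so the events compared by the marginals differ
    only off [E]. *)
Lemma coupling_lower_bound (R : realType) d (T : measurableType d)
    (P P' : probability T R) (Q : probability (T * T)%type R)
    (E : set (T * T)) (A : set T) :
  couplings P P' Q -> measurable E -> measurable A ->
  (forall w, E w -> (A w.1 <-> A w.2)) ->
  (`|P A - P' A| <= 1 - Q E)%E.
Proof.
move=> QPP' mE mA EA.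
have [QA Q'A] := QPP' _ mA.
have mA1 : measurable (fst @^-1` A : set (T * T)).
  by rewrite -[X in measurable X]setTI; exact: measurable_fst.
have mA2 : measurable (snd @^-1` A : set (T * T)).
  by rewrite -[X in measurable X]setTI; exact: measurable_snd.
have finE D : measurable D -> Q D = (fine (Q D))%:E.
  by move=> mD; rewrite fineK// fin_num_measure.
have mEC : measurable (~` E) by exact: measurableC.
have le_offE B B' : measurable B -> measurable B' -> E `&` B `<=` B' ->
    fine (Q B) <= fine (Q B') + fine (Q (~` E)).
  move=> mB mB' EBB'; rewrite -lee_fin EFinD -!finE//.
  apply: (@le_trans _ _ (Q (B' `|` ~` E))); last exact: measureU2.
  apply: le_measure; rewrite ?inE//; first exact: measurableU.
  by move=> w Bw; have [Ew|Ew] := pselect (E w); [left; exact: EBB'|right].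
rewrite -probability_setC// -QA -Q'A /pushforward.
rewrite (finE _ mA1) (finE _ mA2) (finE _ mEC) -EFinB lee_fin ler_norml.
have := le_offE _ _ mA1 mA2 (fun w h => (EA w h.1).1 h.2).
have := le_offE _ _ mA2 mA1 (fun w h => (EA w h.1).2 h.2).
by move=> h1 h2; apply/andP; split; lra.
Qed.

Theorem theorem3p13 (R : realType) (d : measure_display) (T : measurableType d)
    (E : set (T * T)) (G : set (set T)) :
  standard_borel R T ->
  RelationClasses.Equivalence (fun x y : T => E (x, y)) ->
  sigma_algebra [set: T] G ->
  G `<=` measurable ->
  E `<=` indistinguishable G ->
  prod_sigma_algebra G G E ->
  strong_duality R E G.
Proof.
move=> TB [Erefl Esym Etrans] sG GF EG EGG.
(* Membership of [E] in the product of [G] with itself gives its measurability on [T * T], [T * Y]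
   and [Y * Y] at once. *)
have mEprod d1 d2 (T1 : measurableType d1) (T2 : measurableType d2)
    (h1 : T1 -> T) (h2 : T2 -> T) :
    (forall A, G A -> measurable (h1 @^-1` A)) ->
    (forall A, G A -> measurable (h2 @^-1` A)) ->
    measurable [set w | E (h1 w.1, h2 w.2)].
  move=> mh1 mh2; move: E EGG {Erefl Esym Etrans EG}.
  rewrite /prod_sigma_algebra => E.
  suff : <<s [set A `*` B | A in G & B in G] >> `<=`
      [set E | measurable [set w : T1 * T2 | E (h1 w.1, h2 w.2)]] by exact.
  apply: smallest_sub; first split => /=.
  - by rewrite (_ : [set _ | _] = set0)//; apply/seteqP; split.
  - move=> B mB; rewrite (_ : [set _ | _] = ~` [set w | B (h1 w.1, h2 w.2)]);
      first exact: measurableC.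
    by apply/seteqP; split => w /=; tauto.
  - move=> F mF; rewrite (_ : [set _ | _] =
        \bigcup_k [set w | F k (h1 w.1, h2 w.2)]).
      exact: bigcupT_measurable.
    by apply/seteqP; split.
  move=> _ [A GA] [B GB] <- /=.
  exact: (measurableX (mh1 _ GA) (mh2 _ GB)).
pose Y := g_sigma_algebraType G.
have mYE (A : set T) : @measurable _ Y A <-> G A.
  by rewrite /measurable/= sigma_algebra_id.
have mid : measurable_fun setT (idfun : T -> Y).
  by move=> _ A /mYE GA; rewrite setTI; exact: GF.
pose pi := mfun_of mid.
have mE : measurable E.
  have := @mEprod _ _ T T idfun idfun GF GF.
  by rewrite (_ : [set _ | _] = E)//; apply/seteqP; split => -[].
split=> // P P'.
have [L [A [mA L1 L2 LA]]] :=
  maximal_coupling (distribution P pi) (distribution P' pi).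
have [|Q QPP' QE] := @lift_coupling _ _ _ _ Y pi P P' L TB.
  move=> C mC; rewrite /pushforward -L1// -L2//; split.
    by congr (L _); apply/seteqP; split => w /=; tauto.
  by congr (L _); apply/seteqP; split => w /=; tauto.
have GA : G A by exact/mYE.
have lb Q' C : couplings P P' Q' -> G C -> (`|P C - P' C| <= 1 - Q' E)%E.
  move=> Q'PP' GC; apply: coupling_lower_bound => //; first exact: GF.
  by move=> w Ew; exact: EG Ew _ GC.
(* The upper bound chains the lift, [Q (~] E) <= L (~[E)], with the maximality of [L]; the lower
   bound is [lb] for [A], which lies in [G]. *)
have QEA : (1 - Q E = `|P A - P' A|)%E.
  apply/eqP; rewrite eq_le lb// andbT -probability_setC//.
  apply: (@le_trans _ _ (P A - P' A)%E); last exact: lee_abs.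
  have mYG C : G C -> @measurable _ Y C by move/mYE.
  apply: le_trans (LA [set w : Y * Y | E (w.1, w.2)] _ _); last 2 first.
  - exact: (@mEprod _ _ Y Y idfun idfun mYG mYG).
  - exact: Erefl.
  apply: (QE _ [set w : T * Y | E (w.1, w.2)]) => //.
  - exact: (@mEprod _ _ T Y idfun idfun GF mYG).
  - exact: (@mEprod _ _ Y Y idfun idfun mYG mYG).
  - move=> x x' y y' /= xy x'y' yy'.
    exact: Etrans (Etrans _ _ _ xy yy') (Esym _ _ x'y').
exists `|P A - P' A|%E; split; split.
- by exists A.
- by move=> _ [C GC <-]; rewrite -QEA; exact: lb.
- by exists Q.
- by move=> _ [Q' Q'PP' <-]; exact: lb.
Qed.
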